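(* Let $Q$ be a quandle. The number of nonisomorphic constant biquandle structures on $Q$ is equal to the number of conjugacy classes of the group $Aut(Q)$.
   Context: A quandle is a set $Q$ with a binary operation $*$ such that (1) $x*x=x$ for all $x$; (2) for every $y$ the map $S_y(x)=x*y$ is a bijection of $Q$; (3) $(x*y)*z=(x*z)*(y*z)$ for all $x,y,z$. $Aut(Q)$ is the group of bijective quandle homomorphisms $Q\to Q$. A biquandle is a set $B$ with two binary operations $\underline{\ast},\overline{\ast}$ such that (1) $x\,\underline{\ast}\,x=x\,\overline{\ast}\,x$ for all $x$; (2) the maps $x\mapsto x\,\underline{\ast}\,y$ and $x\mapsto x\,\overline{\ast}\,y$ (for every $y\in B$) are bijections of $B$, and the map $(x,y)\mapsto(y\,\overline{\ast}\,x,\;x\,\underline{\ast}\,y)$ is a bijection of $B\times B$; (3) for all $x,y,z\in B$: $(x\,\underline{\ast}\,y)\,\underline{\ast}\,(z\,\underline{\ast}\,y)=(x\,\underline{\ast}\,z)\,\underline{\ast}\,(y\,\overline{\ast}\,z)$, $(x\,\underline{\ast}\,y)\,\overline{\ast}\,(z\,\underline{\ast}\,y)=(x\,\overline{\ast}\,z)\,\underline{\ast}\,(y\,\overline{\ast}\,z)$, and $(x\,\overline{\ast}\,y)\,\overline{\ast}\,(z\,\overline{\ast}\,y)=(x\,\overline{\ast}\,z)\,\overline{\ast}\,(y\,\underline{\ast}\,z)$. A biquandle isomorphism is a bijection preserving both operations. Every automorphism $f\in Aut(Q)$ of a quandle $Q=(X,* )$ defines a constant biquandle structure $\{\beta_y=f\mid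 y\in X\}$ on $Q$, which yields the biquandle $X_f=(X,\underline{\ast},\overline{\ast})$ with $x\,\underline{\ast}\,y=f(x*y)$ and $x\,\overline{\ast}\,y=f(x)$. The constant biquandle structures given by $f,g\in Aut(Q)$ are isomorphic if the biquandles $X_f$ and $X_g$ are isomorphic; the number of nonisomorphic constant biquandle structures is the number (cardinality of the set) of isomorphism classes under this relation. *)

(* Defs.v *)
From HB Require Import structures.
From mathcomp Require Import all_boot.
From mathcomp Require Import mathcomp_extra boolp classical_sets functions.
From mathcomp Require Import cardinality.

Set Implicit Arguments.
Unset Strict Implicit.
Unset Printing Implicit Defensive.

Local Open Scope classical_set_scope.

HB.mixin Record isQuandle (Q : Type) := {
  qop : Q -> Q -> Q;
  qopxx : forall x, qop x x = x;
  qop_bij : forall y, bijective (fun x => qop x y);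
  qopD : forall x y z, qop (qop x y) z = qop (qop x z) (qop y z)
}.

#[short(type="quandleType")]
HB.structure Definition Quandle := { Q of isQuandle Q }.

(* [under x y] is $x\,\underline{\ast}\,y$, [over x y] is $x\,\overline{\ast}\,y$ *)
HB.mixin Record isBiquandle (B : Type) := {
  under : B -> B -> B;
  over : B -> B -> B;
  under_overxx : forall x, under x x = over x x;
  under_bij : forall y, bijective (fun x => under x y);
  over_bij : forall y, bijective (fun x => over x y);
  sideways_bij : bijective (fun p : B * B => (over p.2 p.1, under p.1 p.2));
  under_under : forall x y z,
    under (under x y) (under z y) = under (under x z) (over y z);
  under_over : forall x y z,
    over (under x y) (under z y) = under (over x z) (over y z);
  over_over : forall x y z,
    over (over x y) (over z y) = over (over x z) (under y z)
}.

#[short(type="biquandleType")]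
HB.structure Definition Biquandle := { B of isBiquandle B }.

Definition biquandle_isomorphic (A B : biquandleType) : Prop :=
  exists h : A -> B, [/\ bijective h,
    forall x y, h (under x y) = under (h x) (h y) &
    forall x y, h (over x y) = over (h x) (h y)].

Record aut (Q : quandleType) := Aut {
  aut_fun :> Q -> Q;
  aut_bij : bijective aut_fun;
  autM : {morph aut_fun : x y / qop x y}
}.

(* The group Aut(Q), with composition (f * g)(x) = f (g x) as product. *)
Section AutGroup.
Variable Q : quandleType.
Implicit Types f g : aut Q.

Lemma aut_ext f g : aut_fun f =1 aut_fun g -> f = g.
Proof.
case: f g => [f fb fM] [g gb gM] /= /funext fg; subst g.
by rewrite (Prop_irrelevance fb gb) (Prop_irrelevance fM gM).
Qed.

Definition aut_one : aut Q :=
  @Aut Q id (Bijective (frefl _) (frefl _)) (fun _ _ => erefl).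

Lemma aut_mulM f g : {morph f \o g : x y / qop x y}.
Proof. by move=> x y /=; rewrite !autM. Qed.

Definition aut_mul f g : aut Q :=
  Aut (bij_comp (aut_bij f) (aut_bij g)) (@aut_mulM f g).

Lemma aut_inv_subproof f : exists g : Q -> Q, cancel f g /\ cancel g f.
Proof. by have [g fK gK] := aut_bij f; exists g. Qed.

Definition aut_inv_fun f : Q -> Q := projT1 (cid (aut_inv_subproof f)).

Lemma aut_funK f : cancel f (aut_inv_fun f).
Proof. by rewrite /aut_inv_fun; case: cid => g []. Qed.

Lemma aut_inv_funK f : cancel (aut_inv_fun f) f.
Proof. by rewrite /aut_inv_fun; case: cid => g []. Qed.

Lemma aut_invM f : {morph aut_inv_fun f : x y / qop x y}.
Proof.
by move=> x y; apply: (can_inj (aut_funK f)); rewrite autM !aut_inv_funK.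
Qed.

Definition aut_inv f : aut Q :=
  Aut (Bijective (aut_inv_funK f) (aut_funK f)) (@aut_invM f).

HB.instance Definition _ := gen_eqMixin (aut Q).
HB.instance Definition _ := gen_choiceMixin (aut Q).

Lemma aut_mulA : associative aut_mul.
Proof. by move=> f g h; apply: aut_ext. Qed.

Lemma aut_mul1 : left_id aut_one aut_mul.
Proof. by move=> f; apply: aut_ext. Qed.

Lemma aut_mulr1 : right_id aut_one aut_mul.
Proof. by move=> f; apply: aut_ext. Qed.

Lemma aut_mulV : left_inverse aut_one aut_inv aut_mul.
Proof. by move=> f; apply: aut_ext; apply: aut_funK. Qed.

Lemma aut_mulrV : right_inverse aut_one aut_inv aut_mul.
Proof. by move=> f; apply: aut_ext; apply: aut_inv_funK. Qed.

HB.instance Definition _ := isGroup.Build (aut Q)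
  aut_mulA aut_mul1 aut_mulr1 aut_mulV aut_mulrV.

End AutGroup.

(* The biquandle X_f of the constant structure given by f : an alias of the
   carrier of Q. *)
Definition constant_biquandle (Q : quandleType) (f : aut Q) : Type := Q.

Section ConstantBiquandle.
Variables (Q : quandleType) (f : aut Q).

Definition cunder (x y : Q) : Q := f (qop x y).
Definition cover (x y : Q) : Q := f x.

Lemma cunder_coverxx x : cunder x x = cover x x.
Proof. by rewrite /cunder qopxx. Qed.

Lemma cunder_bij y : bijective (fun x => cunder x y).
Proof. exact: (bij_comp (aut_bij f) (qop_bij y)). Qed.

Lemma cover_bij y : bijective (fun x => cover x y).
Proof. exact: (aut_bij f). Qed.

Lemma csideways_bij :
  bijective (fun p : Q * Q => (cover p.2 p.1, cunder p.1 p.2)).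
Proof.
have S_inv y : exists g, cancel ((@qop Q)^~ y) g /\ cancel g ((@qop Q)^~ y).
  by have [g K1 K2] := qop_bij y; exists g.
have /choice[S' S'P] := S_inv.
exists (fun p => (S' (aut_inv f p.1) (aut_inv f p.2), aut_inv f p.1)).
  by move=> [x y]; rewrite /cover /cunder /= !aut_funK (S'P y).1.
move=> [a b]; rewrite /cover /cunder /=.
by have /= -> := (S'P (aut_inv_fun f a)).2; rewrite !aut_inv_funK.
Qed.

Lemma cunder_cunder x y z :
  cunder (cunder x y) (cunder z y) = cunder (cunder x z) (cover y z).
Proof. by rewrite /cunder /cover -!autM -qopD. Qed.

Lemma cunder_cover x y z :
  cover (cunder x y) (cunder z y) = cunder (cover x z) (cover y z).
Proof. by rewrite /cunder /cover autM. Qed.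

Lemma cover_cover x y z :
  cover (cover x y) (cover z y) = cover (cover x z) (cunder y z).
Proof. by []. Qed.

HB.instance Definition _ := isBiquandle.Build (constant_biquandle f)
  cunder_coverxx cunder_bij cover_bij csideways_bij
  cunder_cunder cunder_cover cover_cover.

End ConstantBiquandle.

Definition constant_structure_class (Q : quandleType) (f : aut Q) : set (aut Q) :=
  [set g | biquandle_isomorphic (constant_biquandle f) (constant_biquandle g)].

Definition constant_structure_classes (Q : quandleType) : set (set (aut Q)) :=
  range (@constant_structure_class Q).
Arguments constant_structure_classes Q : clear implicits.

Definition conjugacy_class (G : groupType) (x : G) : set G :=
  range (fun y : G => conjg x y).

Definition conjugacy_classes (G : groupType) : set (set G) :=
  range (@conjugacy_class G).
Arguments conjugacy_classes G : clear implicits.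

(* Main.v *)
(* An isomorphism h : X_f -> X_g intertwines f and g because it preserves the
   upper operations; cancelling g in h (f (x * y)) = g (h x * h y) then shows
   that h is an automorphism of Q. So the class of f is its conjugacy class. *)
Require Import Defs.
From mathcomp Require Import all_boot cardinality.
From mathcomp Require Import boolp classical_sets.

Local Open Scope card_scope.

Lemma constant_biquandle_isomorphicP (Q : quandleType) (f g : aut Q) :
  biquandle_isomorphic (constant_biquandle f) (constant_biquandle g) <->
  exists h : aut Q, forall x, h (f x) = g (h x).
Proof.
split=> [[h [hb hU hO]]|[h hfg]].
  (* The upper operation ignores its second argument, so [x] serves there. *)
  have hfg x : h (f x) = g (h x) by exact: (hO x x).
  have hM : {morph (h : Q -> Q) : x y / qop x y}.
    move=> x y; apply: (bij_inj (aut_bij g)).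
    by rewrite -hfg; exact: (hU x y).
  by exists (Aut hb hM).
exists h; split; first exact: aut_bij.
- by move=> x y; rewrite /under /= /cunder hfg autM.
- by move=> x y; rewrite /over /= /cover hfg.
Qed.

Lemma constant_structure_classE (Q : quandleType) (f : aut Q) :
  constant_structure_class f = conjugacy_class f.
Proof.
apply/seteqP; split=> g.
  (* As [conjg f k] is k^-1 f k, the relation h f = g h makes g = h f h^-1 the conjugate of [f] by
     h^-1, not by [h]. *)
  move/constant_biquandle_isomorphicP => [h hfg]; exists (aut_inv h) => //.
  apply: aut_ext => x; apply: (can_inj (aut_funK (aut_inv h))).
  rewrite aut_inv_funK; apply: (can_inj (aut_funK h)).
  by rewrite hfg !aut_inv_funK.
move=> [h _ <-]; apply/constant_biquandle_isomorphicP.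
(* Now g = h^-1 f h, hence h^-1 f = g h^-1. *)
exists (aut_inv h) => x; rewrite conjgE /=.
by rewrite aut_inv_funK.
Qed.

Theorem corollary2p9 (Q : quandleType) :
  constant_structure_classes Q #= conjugacy_classes (aut Q).
Proof.
(* Both sides become the same set of subsets of [aut Q], not merely equinumerous ones. *)
rewrite /constant_structure_classes (funext (@constant_structure_classE Q)).
exact: card_eqxx.
Qed.
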